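(* Let $(r_n)_{n\ge 1}$ be a sequence of radii with $r_n \geq 4^{n/5}$ for all $n$. Then $(r_n)$ is undercooked, i.e. there is a constant $C>0$ independent of $n$ such that $\mathrm{Fav}_{\sigma^{(n)}}(\mathcal{K}_n)\geq C\,\frac{\log n}{n}$ for all $n\ge 2$, where $\sigma^{(n)}$ is the map $\sigma$ built from $f_{r_n}$ as described in the context.
   Context: Middle-half Cantor set: $\mathcal{C}_0=[0,1]$ and $\mathcal{C}_{n+1}$ is obtained from $\mathcal{C}_n$ by replacing each of its intervals by the first and last quarters of that interval (removing the middle half). Thus $\mathcal{C}_n$ is a union of $2^n$ intervals of length $4^{-n}$, and $\mathcal{K}_n:=\mathcal{C}_n\times\mathcal{C}_n\subset\mathbb{R}^2=\mathbb{C}$ is a union of $4^n$ closed squares of side $4^{-n}$. For an angle $\theta$, $\mathrm{Proj}_\theta$ denotes orthogonal projection onto the line through the origin in direction $e^{i\theta}$, and $|\cdot|$ denotes one-dimensional Lebesgue measure on that line. For a map $T:\mathbb{C}\times S^1\to\mathbb{C}$ write $T_\theta(z):=T(z,e^{i\theta})$ and define, for $E\subset\mathbb{C}$, $\mathrm{Fav}_T(E):=\frac{1}{2\pi}\int_0^{2\pi}|\mathrm{Proj}_\theta(T_\theta(E))|\,d\theta$. For $r>0$ define $f_r(y):=r-\sqrt{r^2-y^2}$ if $|y|\le 2$ and $f_r(y):=r-\sqrt{r^2-4}$ otherwise. Let $\sigma_0(x,y):=(x-f_r(y),y)$, let $R_\theta$ be clockwise rotation of the plane by the angle $\theta$, and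 set $\sigma_\theta:=R_{-\theta}\circ\sigma_0\circ R_\theta$; this defines $\sigma:\mathbb{C}\times S^1\to\mathbb{C}$ by $\sigma(z,e^{i\theta})=\sigma_\theta(z)$. A sequence of maps $T_n:\mathbb{C}\times S^1\to\mathbb{C}$ is an undercooking of the plane if there is $C>0$ independent of $n$ with $\mathrm{Fav}_{T_n}(\mathcal{K}_n)\ge C\frac{\log n}{n}$; a sequence $(r_n)$ is undercooked if the maps $\sigma$ built from $f_{r_n}$ form an undercooking. *)

(* Defs.v *)
From HB Require Import structures.
From mathcomp Require Import all_boot all_order all_algebra.
From mathcomp Require Import all_classical all_reals all_analysis.
Set Implicit Arguments. Unset Strict Implicit. Unset Printing Implicit Defensive.
Import Order.TTheory GRing.Theory Num.Theory.
Local Open Scope classical_set_scope.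
Local Open Scope ring_scope.

Section Defs.
Variable R : realType.

(* Left endpoints of the 2^n intervals of length 4^-n making up C_n:
   A_0 = {0}; each interval [a, a + 4^-n] is replaced by its first quarter
   [a, a + 4^-(n+1)] and its last quarter [a + 3*4^-(n+1), a + 4^-n]. *)
Fixpoint cantor_left (n : nat) : set R :=
  match n with
  | O => [set 0]
  | S m => [set b | exists2 a, cantor_left m a &
              (b = a \/ b = a + 3 * (4 ^- m.+1))]
  end.

Definition cantorC (n : nat) : set R :=
  \bigcup_(a in cantor_left n) `[a, a + 4 ^- n]%classic.

Definition cantorK (n : nat) : set (R * R) :=
  [set z | cantorC n z.1 /\ cantorC n z.2].

(* Orthogonal projection onto the line through 0 in direction e^{i theta},
   identified isometrically with R via the coordinate <z, e^{i theta}>. *)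
Definition proj (theta : R) (z : R * R) : R :=
  z.1 * cos theta + z.2 * sin theta.

(* Favard length of E with respect to a family T_theta (T_theta(z) = T(z, e^{i theta})):
   (1/2pi) int_0^{2pi} |Proj_theta(T_theta(E))| dtheta, with |.| Lebesgue (outer) measure. *)
Definition Fav (T : R -> R * R -> R * R) (E : set (R * R)) : \bar R :=
  (((2 * pi)^-1)%:E *
   \int[lebesgue_measure]_(theta in `[0%R, (2 * pi)%R]%classic)
       lebesgue_measure (proj theta @` (T theta @` E)))%E.

Definition f_r (r y : R) : R :=
  if `|y| <= 2 then r - Num.sqrt (r ^+ 2 - y ^+ 2) else r - Num.sqrt (r ^+ 2 - 4).

Definition sigma0 (r : R) (z : R * R) : R * R := (z.1 - f_r r z.2, z.2).

Definition rotcw (theta : R) (z : R * R) : R * R :=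
  (z.1 * cos theta + z.2 * sin theta, - z.1 * sin theta + z.2 * cos theta).

Definition sigma (r : R) (theta : R) (z : R * R) : R * R :=
  rotcw (- theta) (sigma0 r (rotcw theta z)).

End Defs.

(* Main.v *)
(* Second moment method of Bateman and Volberg. Write the angle as theta0 + s,
   where theta0 is the direction of slope 2. In the ring of angles with s of order
   4^-j, two squares whose indices first differ in a digit of weight 4^l can only
   collide after projection if their indices, as integers, are within O(4^(l-j)) of
   each other although they lie in different blocks of length 4^l; both indices
   must then be close to a block boundary, so only a fraction 4^(-2j) of the pairs
   is left. Summed over l and over the sampled angles of the ring, the number of
   collisions is O(n 4^(2n-2j)) as long as 4^j <= n, hence each ring contributes a
   constant times 1/n to the Favard length, and there are about log n rings.

   The curvature is handled by elementary algebra: up to the shift by r, the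
   curved projection p of z is the abscissa of the centre of the circle of radius
   r through z, so p^2 - 2 p x + |z|^2 = r^2 where x is the linear projection.
   Subtracting two such equations shows that the curvature perturbs the slope
   between two points by O(1/r), and r is much larger than n. *)
Require Import Defs.
From HB Require Import structures.
From mathcomp Require Import all_boot all_order all_algebra.
From mathcomp Require Import all_classical all_reals all_analysis.
From mathcomp Require Import measurable_realfun.
From mathcomp Require Import ring lra zify.
Set Implicit Arguments. Unset Strict Implicit. Unset Printing Implicit Defensive.
Import Order.TTheory GRing.Theory Num.Theory.
Import numFieldNormedType.Exports Defs.
Local Open Scope classical_set_scope.
Local Open Scope ring_scope.

Section Integral.
Context d (T : measurableType d) (R : realType).
Variables (mu : {measure set T -> \bar R}) (D : set T).
Implicit Types f g : T -> \bar R.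

(* Neither function is assumed measurable: the integral of a nonnegative
   function is the supremum of the integrals of the simple functions below it. *)
Lemma ge0_le_integral_nonmeasurable f g :
  (forall x, D x -> (0 <= f x)%E) -> (forall x, D x -> (f x <= g x)%E) ->
  (\int[mu]_(x in D) f x <= \int[mu]_(x in D) g x)%E.
Proof.
move=> f0 fg; have g0 x : D x -> (0 <= g x)%E.
  by move=> Dx; exact: le_trans (f0 x Dx) (fg x Dx).
rewrite !ge0_integralE//; apply: ereal_sup_le => _ [h hf <-].
by exists h => // x; rewrite (le_trans (hf x))// lee_restrict.
Qed.

Lemma integral_step_function (K : nat) (c : nat -> R) (F : nat -> set T) :
  measurable D -> (forall i, measurable (F i)) -> (forall i, 0 <= c i) ->
  (forall i, (i < K)%N -> F i `<=` D) ->
  (\int[mu]_(x in D) (\sum_(i < K) c i * \1_(F i) x)%:E =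
   \sum_(i < K) (c i)%:E * mu (F i))%E.
Proof.
move=> mD mF c0 FD.
have m1 i : measurable_fun D (fun x => (\1_(F i) x)%:E : \bar R).
  exact/measurable_EFinP/measurable_indic.
under eq_integral do rewrite -sumEFin.
under eq_integral do under eq_bigr do rewrite EFinM.
rewrite ge0_integral_sum//; last 2 first.
- by move=> i; exact: emeasurable_funM.
- by move=> i x _; rewrite -EFinM lee_fin mulr_ge0.
apply: eq_bigr => i _; rewrite ge0_integralZl//.
  by rewrite integral_indic// setIidl//; exact: FD.
by rewrite lee_fin.
Qed.

End Integral.

Section GridCells.
Variable R : realType.
Implicit Types (a d x y : R) (v : int) (A : set R).

Lemma floor_div_eq_close d x y : 0 < d ->
  Num.floor (x / d) = Num.floor (y / d) -> `|x - y| <= d.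
Proof.
move=> d0 xy; have := floor_itv (x / d); have := floor_itv (y / d).
rewrite xy intrD !ler_pdivlMr// !ltr_pdivrMr// => /andP[y1 y2] /andP[x1 x2].
by rewrite ler_norml; lra.
Qed.

Definition grid_cell a d v : set R := `[a + v%:~R * d, a + (v + 1)%:~R * d[%classic.

Lemma measurable_grid_cell a d v : measurable (grid_cell a d v).
Proof. exact: measurable_itv. Qed.

Lemma grid_cellP a d v x : 0 < d ->
  grid_cell a d v x <-> Num.floor ((x - a) / d) = v.
Proof.
move=> d0; rewrite /grid_cell/= in_itv/= -lerBrDl -ltrBlDl.
rewrite -ler_pdivlMr// -ltr_pdivrMr//; split; first exact: floor_def.
by move=> <-; exact: floor_itv.
Qed.

Lemma trivIset_grid_cell (D : set int) a d : 0 < d -> trivIset D (grid_cell a d).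
Proof.
by move=> d0 v w _ _ [x [/(grid_cellP _ _ _ d0)<- /(grid_cellP _ _ _ d0)]].
Qed.

Lemma lebesgue_measure_grid_cell a d v : 0 < d ->
  lebesgue_measure (grid_cell a d v) = d%:E.
Proof.
move=> d0; rewrite lebesgue_measure_itv/= lte_fin intrD mulrDl mul1r.
by rewrite addrA ltrDl d0 -EFinD; congr (_%:E); ring.
Qed.

Lemma lebesgue_measure_grid_cells_ge a d (vs : seq int) A : 0 < d ->
  uniq vs -> (forall v, v \in vs -> grid_cell a d v `<=` A) ->
  (((size vs)%:R * d)%:E <= lebesgue_measure A)%E.
Proof.
move=> d0 uvs vsA.
have -> : (((size vs)%:R * d)%:E =
    lebesgue_measure (\bigcup_(v in [set` vs]) grid_cell a d v))%E.
  rewrite measure_fin_bigcup//.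
  - rewrite -fsbig_seq//=; under eq_bigr do rewrite lebesgue_measure_grid_cell//.
    by rewrite sumEFin big_const_seq count_predT iter_addr_0 mulr_natl.
  - exact: finite_seq.
  - exact: trivIset_grid_cell.
  - by move=> v _; exact: measurable_grid_cell.
by apply: le_mu_ext => x [v /vsA]; exact.
Qed.

Lemma grid_step_function_cell a d x (K : nat) (c : nat -> R) (i : 'I_K) : 0 < d ->
  grid_cell a d i x -> \sum_(j < K) c j * \1_(grid_cell a d j) x = c i.
Proof.
move=> d0 xi; rewrite (bigD1 i)//= indicE mem_set// mulr1 big1 ?addr0//.
move=> j ji; rewrite indicE memNset ?mulr0// => xj; move/eqP: ji; apply.
apply: val_inj; move: xi xj => /(grid_cellP _ _ _ d0) + /(grid_cellP _ _ _ d0).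
by move=> -> [].
Qed.

Lemma integral_grid_ge a d (K : nat) (c : nat -> R) (D : set R) (G : R -> \bar R) :
  0 < d -> measurable D -> (forall i : nat, (i < K)%N -> grid_cell a d i `<=` D) ->
  (forall x, D x -> (0 <= G x)%E) -> (forall i, 0 <= c i) ->
  (forall (i : nat) x, (i < K)%N -> grid_cell a d i x -> ((c i)%:E <= G x)%E) ->
  ((d * \sum_(i < K) c i)%:E <= \int[lebesgue_measure]_(x in D) G x)%E.
Proof.
move=> d0 mD cellD G0 c0 cG.
have -> : ((d * \sum_(i < K) c i)%:E =
    \int[lebesgue_measure]_(x in D) (\sum_(i < K) c i * \1_(grid_cell a d i) x)%:E)%E.
  transitivity (\sum_(i < K) (c i)%:E * lebesgue_measure (grid_cell a d i))%E.
    rewrite mulr_sumr -sumEFin; apply: eq_bigr => i _.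
    by rewrite lebesgue_measure_grid_cell// -EFinM mulrC.
  have step := @integral_step_function _ _ R lebesgue_measure D K c
    (fun i : nat => grid_cell a d i).
  by rewrite -step// => i; exact: measurable_grid_cell.
apply: ge0_le_integral_nonmeasurable => x Dx.
  by rewrite lee_fin sumr_ge0// => i _; rewrite mulr_ge0.
have [[i xi]|nx] := pselect (exists i : 'I_K, grid_cell a d i x); last first.
  rewrite big1 ?G0// => i _; rewrite indicE memNset ?mulr0// => xi.
  by apply: nx; exists i.
by rewrite (grid_step_function_cell c d0 xi); exact: cG.
Qed.

End GridCells.

Section CantorNumerators.
Local Open Scope nat_scope.
Implicit Types (bit : nat -> bool) (k l m n : nat).

(* The base-4 digit a + 2b of the index m stands for the pair (a, b) of binary
   choices of first or last quarter in the two coordinates; the lower left corner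
   of the square indexed by m is (xnum n m, ynum n m) / 4^n. *)
Fixpoint cantor_num bit n m : nat :=
  if n is k.+1 then 4 * cantor_num bit k (m %/ 4) + 3 * bit (m %% 4) else 0.

Definition xnum : nat -> nat -> nat := cantor_num odd.

Definition ynum : nat -> nat -> nat := cantor_num (leq 2).

Lemma cantor_num_lt bit n m : cantor_num bit n m < 4 ^ n.
Proof.
elim: n m => [|n ih] m //=; rewrite expnS.
by have := ih (m %/ 4); case: (bit _); lia.
Qed.

Lemma cantor_num_cat bit k l m :
  cantor_num bit (k + l) m =
  4 ^ l * cantor_num bit k (m %/ 4 ^ l) + cantor_num bit l m.
Proof.
elim: l m => [|l ih] m; first by rewrite addn0 expn0 divn1 mul1n addn0.
by rewrite addnS /= ih expnS divnMA mulnDr !mulnA addnA.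
Qed.

Lemma cantor_num_block bit n l m m' : l <= n -> m %/ 4 ^ l = m' %/ 4 ^ l ->
  `|cantor_num bit n m - cantor_num bit n m'| < 4 ^ l.
Proof.
move=> /subnK <- e; rewrite !cantor_num_cat e.
by have := cantor_num_lt bit l m; have := cantor_num_lt bit l m'; lia.
Qed.

Lemma xnum_ynum n m : m < 4 ^ n -> xnum n m + 2 * ynum n m = 3 * m.
Proof.
elim: n m => [|n ih] m; first by rewrite expn0; case: m.
rewrite expnS /xnum /ynum /= => mn; have := ih (m %/ 4) _; rewrite /xnum /ynum.
have := divn_eq m 4; have := ltn_pmod m (isT : 0 < 4).
by case: (m %% 4) => [|[|[|[|//]]]]; lia.
Qed.

Definition splits_at l m m' : bool :=
  (m %/ 4 ^ l.+1 == m' %/ 4 ^ l.+1) && (m %/ 4 ^ l != m' %/ 4 ^ l).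

Lemma exists_split n m m' : m < 4 ^ n -> m' < 4 ^ n -> m != m' ->
  exists2 l, l < n & splits_at l m m'.
Proof.
elim: n m m' => [|n ih] m m'; first by rewrite expn0; lia.
rewrite expnS => mn m'n mm'; have [e|ne] := eqVneq (m %/ 4) (m' %/ 4).
  by exists 0; rewrite // /splits_at expn1 expn0 !divn1 e eqxx.
have [|||l ln] := ih (m %/ 4) (m' %/ 4); [lia|lia|by []|].
by rewrite /splits_at -!divnMA -!expnS => s; exists l.+1.
Qed.

Lemma cantor_num_far bit n l m m' : l < n -> m %/ 4 ^ l.+1 = m' %/ 4 ^ l.+1 ->
  bit ((m %/ 4 ^ l) %% 4) != bit ((m' %/ 4 ^ l) %% 4) ->
  2 * 4 ^ l < `|cantor_num bit n m - cantor_num bit n m'|.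
Proof.
move=> /subnK <-; rewrite addnS -addSn !cantor_num_cat /= -!divnMA -expnSr => <-.
have := cantor_num_lt bit l m; have := cantor_num_lt bit l m'.
by case: (bit _); case: (bit _); lia.
Qed.

Lemma split_far n l m m' : l < n -> splits_at l m m' ->
  2 * 4 ^ l < `|xnum n m - xnum n m'| \/ 2 * 4 ^ l < `|ynum n m - ynum n m'|.
Proof.
move=> ln /andP[/eqP e ne].
have : (m %/ 4 ^ l) %% 4 != (m' %/ 4 ^ l) %% 4.
  apply: contra ne => /eqP d; move: e; rewrite expnSr !divnMA => e.
  by rewrite (divn_eq (m %/ 4 ^ l) 4) (divn_eq (m' %/ 4 ^ l) 4) e d.
have bits d d' : d < 4 -> d' < 4 -> d != d' ->
    (odd d != odd d') || ((1 < d) != (1 < d')).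
  by case: d => [|[|[|[|//]]]]; case: d' => [|[|[|[|//]]]].
move=> /bits; rewrite !ltn_pmod// => /(_ isT isT)/orP[] d; [left|right];
  exact: cantor_num_far.
Qed.

End CantorNumerators.

Lemma big_nat_telescope (V : nmodType) (F : nat -> V) (u : nat -> nat) a b :
  (forall k, (u k <= u k.+1)%N) -> (a < b)%N ->
  \sum_(u a <= i < u b) F i = \sum_(a <= k < b) \sum_(u k <= i < u k.+1) F i.
Proof.
move=> umono ab.
rewrite (telescope_big (fun k l => \sum_(u k <= i < u l) F i)) ?ab// => k /andP[ak _].
rewrite -big_cat_nat//; elim: k ak => // k ih; rewrite ltnS leq_eqVlt.
by case/predU1P => [->//|/ih uak]; exact: leq_trans uak (umono _).
Qed.

Section CountingPairs.
Local Open Scope nat_scope.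
Implicit Types (b : nat -> bool) (i m : nat).

Lemma sum_bool_itv_le N b a k : (forall i, i < N -> b i -> a <= i < a + k) ->
  \sum_(i < N) b i <= k.
Proof.
move=> bN; rewrite -(big_mkord xpredT (fun i => nat_of_bool (b i))).
have -> : \sum_(0 <= i < N) b i = size [seq i <- iota 0 N | b i].
  by rewrite size_filter -sum1_count /index_iota subn0 [RHS]big_mkcond.
rewrite -[leqRHS](size_iota a); apply: uniq_leq_size.
  by rewrite filter_uniq// iota_uniq.
by move=> i; rewrite mem_filter !mem_iota add0n => /andP[bi iN]; exact: bN.
Qed.

Lemma sum_bool_ball_le N b m r : (forall i, i < N -> b i -> `|m - i| <= r) ->
  \sum_(i < N) b i <= 2 * r + 1.
Proof.
move=> bN; apply: (sum_bool_itv_le (a := m - r)) => i iN bi.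
by have := bN i iN bi; lia.
Qed.

Lemma sum_bool_diameter_le N b r :
  (forall i i', i < N -> i' < N -> b i -> b i' -> `|i - i'| <= r) ->
  \sum_(i < N) b i <= 2 * r + 1.
Proof.
move=> br; have [i bi|nb] := pickP (fun i : 'I_N => b i); last first.
  by rewrite big1// => i _; rewrite nb.
by apply: (@sum_bool_ball_le _ _ i) => i' i'N bi'; exact: br.
Qed.

Lemma sum_modn B q (f : nat -> nat) :
  \sum_(m < B * q) f (m %% q) = B * \sum_(t < q) f t.
Proof.
rewrite -(big_mkord xpredT (fun m => f (m %% q))) -(big_mkord xpredT f) big_nat_mul.
rewrite -[B in RHS]subn0 -sum_nat_const_nat; apply: eq_bigr => k _.
rewrite -{1}[k * q]add0n mulSn big_addn addnK.
by apply: eq_big_nat => i /= iq; rewrite addnC modnMDl modn_small.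
Qed.

Lemma sum_close_pairs_le N r :
  \sum_(m < N) \sum_(m' < N) (`|m - m'| <= r) <= N * (2 * r + 1).
Proof.
rewrite -[N in N * _]card_ord -sum_nat_const; apply: leq_sum => m _.
by apply: (@sum_bool_ball_le _ (fun m' => `|m - m'| <= r) m).
Qed.

(* Both members of such a pair lie within r of a multiple of q. *)
Lemma sum_close_pairs_across_blocks_le B q r : 0 < q ->
  \sum_(m < B * q) \sum_(m' < B * q) ((m %/ q != m' %/ q) && (`|m - m'| <= r))
    <= B * (2 * r * (2 * r + 1)).
Proof.
move=> q0; pose near_boundary t := (q <= t + r) + (t < r).
have near (m m' : nat) : m %/ q != m' %/ q -> `|m - m'| <= r ->
    0 < near_boundary (m %% q).
  rewrite /near_boundary => ne mm'.
  have := divn_eq m q; have := divn_eq m' q.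
  have := ltn_pmod m q0; have := ltn_pmod m' q0.
  move: (m %/ q) (m' %/ q) (m %% q) (m' %% q) ne => d d' t t' ne t'q tq em' em.
  rewrite addn_gt0 !lt0b; apply/orP.
  have [dd'|d'd] : d.+1 * q <= d' * q \/ d'.+1 * q <= d * q.
    by rewrite !leq_mul2r; lia.
  - by left; lia.
  - by right; lia.
apply: (@leq_trans (\sum_(m < B * q) near_boundary (m %% q) * (2 * r + 1))).
  apply: leq_sum => m _; have [far|] := posnP (near_boundary (m %% q)).
    rewrite far big1// => m' _; apply/eqP; rewrite eqb0; apply/negP => /andP[ne mm'].
    by have := near _ _ ne mm'; rewrite far.
  move=> /(@leq_pmull (2 * r + 1)) h; apply: leq_trans h.
  apply: (@sum_bool_ball_le _ (fun m' => (m %/ q != m' %/ q) && (`|m - m'| <= r)) m).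
  by move=> m' _ /andP[].
rewrite -big_distrl/= sum_modn -mulnA leq_mul2l leq_mul2r; apply/orP; right.
apply/orP; right; rewrite big_split/= mul2n -addnn leq_add//.
  by apply: (@sum_bool_itv_le _ (fun t => q <= t + r) (q - r)) => t tq; lia.
by apply: (@sum_bool_itv_le _ (fun t => t < r) 0) => t tq; lia.
Qed.

End CountingPairs.

Section CountingCollisions.
Local Open Scope nat_scope.
Variables (n j K D : nat) (collide : nat -> rel nat).

(* collide i m m' stands for: at the i-th angle the squares m and m' project to
   the same cell. *)
Hypothesis collide_close : forall l m m' i, l < n -> m < 4 ^ n -> m' < 4 ^ n ->
  splits_at l m m' -> i < K -> collide i m m' -> `|m - m'| <= 3 * 4 ^ (l.+1 - j).
Hypothesis collide_angles : forall l m m' i i', l < n -> splits_at l m m' ->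
  i < K -> i' < K -> collide i m m' -> collide i' m m' ->
  `|i - i'| <= D * 4 ^ (n - l).

Definition close_split l m m' : bool :=
  [&& j <= l.+1, m %/ 4 ^ l != m' %/ 4 ^ l & `|m - m'| <= 3 * 4 ^ (l.+1 - j)].

Lemma sum_collisions_pair_le m m' : m < 4 ^ n -> m' < 4 ^ n ->
  \sum_(i < K) collide i m m' <=
    K * (`|m - m'| <= 3) +
    \sum_(l < n) close_split l m m' * ((2 * D + 1) * 4 ^ (n - l)).
Proof.
move=> mn m'n.
have le_K : \sum_(i < K) collide i m m' <= K.
  by rewrite -[leqRHS]card_ord -sum1_card leq_sum// => i _; case: (collide _ _ _).
have [near|/negbTE far] := boolP (`|m - m'| <= 3).
  by rewrite muln1 (leq_trans le_K)// leq_addr.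
rewrite muln0 add0n.
have [i|none] := pickP (fun i : 'I_K => collide i m m'); last first.
  by rewrite big1// => i _; rewrite none.
move=> ci; have [|l ln s] := exists_split mn m'n.
  by apply/eqP => e; move: far; rewrite e; lia.
have close := collide_close ln mn m'n s (ltn_ord i) ci.
have cs : close_split l m m'.
  move: s; rewrite /close_split close => /andP[_ ->]; rewrite !andbT.
  by rewrite leqNgt; apply/negP => lj; move: close; rewrite (eqP (ltnW lj)); lia.
rewrite (bigD1 (Ordinal ln))//= cs mul1n (leq_trans _ (leq_addr _ _))//.
apply: leq_trans
  (@sum_bool_diameter_le _ (fun i => collide i m m') (D * 4 ^ (n - l)) _) _.
  by move=> i1 i2 *; exact: (collide_angles ln s).
by rewrite mulnDl mul1n mulnA leq_add2l expn_gt0.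
Qed.

Lemma sum_close_split_le l : l < n ->
  (\sum_(m < 4 ^ n) \sum_(m' < 4 ^ n) close_split l m m') *
    ((2 * D + 1) * 4 ^ (n - l)) <= 672 * (2 * D + 1) * 4 ^ (2 * (n - j)).
Proof.
move=> ln; rewrite /close_split; have [jl|_] := leqP j l.+1; last first.
  by rewrite !big1// => m _; rewrite big1.
set b := 4 ^ (n - l); set e := 4 ^ (l.+1 - j).
have := @sum_close_pairs_across_blocks_le b (4 ^ l) (3 * e).
rewrite expn_gt0 -expnD subnK; last exact: ltnW.
move=> /(_ isT) pairs; apply: leq_trans (leq_mul pairs (leqnn _)) _.
have be : b * b * (e * e) = 16 * 4 ^ (2 * (n - j)).
  by rewrite /b /e -!expnD -[16]/(4 ^ 2) -expnD; congr (_ ^ _); lia.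
have e0 : 0 < e by rewrite expn_gt0.
rewrite [leqLHS](_ : _ = b * b * (6 * e * (6 * e + 1)) * (2 * D + 1)); last by ring.
rewrite [leqRHS](_ : _ = b * b * (42 * (e * e)) * (2 * D + 1)); last first.
  by transitivity (42 * (16 * 4 ^ (2 * (n - j))) * (2 * D + 1)); [|rewrite -be]; ring.
by rewrite leq_mul2r leq_mul2l; apply/orP; right; apply/orP; right; nia.
Qed.

Lemma sum_collisions_le :
  \sum_(i < K) \sum_(m < 4 ^ n) \sum_(m' < 4 ^ n) collide i m m' <=
    7 * 4 ^ n * K + n * (672 * (2 * D + 1) * 4 ^ (2 * (n - j))).
Proof.
rewrite exchange_big/=; under eq_bigr do rewrite exchange_big/=.
apply: (@leq_trans (\sum_(m < 4 ^ n) \sum_(m' < 4 ^ n)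
    (K * (`|m - m'| <= 3) +
     \sum_(l < n) close_split l m m' * ((2 * D + 1) * 4 ^ (n - l))))).
  by apply: leq_sum => m _; apply: leq_sum => m' _; exact: sum_collisions_pair_le.
under eq_bigr do rewrite big_split/=; rewrite big_split/= leq_add//.
  under eq_bigr do rewrite -big_distrr/=.
  by rewrite -big_distrr/= mulnC leq_mul2r mulnC sum_close_pairs_le orbT.
under eq_bigr do rewrite exchange_big/=; rewrite exchange_big/=.
rewrite -[X in _ <= X * _]card_ord -sum_nat_const; apply: leq_sum => l _.
under eq_bigr do rewrite -big_distrl/=.
by rewrite -big_distrl/=; exact: sum_close_split_le.
Qed.

End CountingCollisions.

Section SecondMoment.
Variables (R : realFieldType) (I T : Type) (E : eqType).
Implicit Types (s : seq T) (r : seq I).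

(* A value taken a times contributes 1 on the right and 2ta - (ta)^2 on the left. *)
Lemma size_undup_map_ge s (f : T -> E) (t : R) :
  2 * t * (size s)%:R - t ^+ 2 * (\sum_(x <- s) \sum_(y <- s) (f x == f y))%:R
    <= (size (undup (map f s)))%:R.
Proof.
pose mult v := count_mem v (map f s).
have sumE (g : E -> R) :
    \sum_(x <- s) g (f x) = \sum_(v <- undup (map f s)) (mult v)%:R * g v.
  rewrite -(big_map f xpredT g) -big_undup_iterop_count.
  by apply: eq_bigr => v _; rewrite mulr_natl Monoid.iteropE iter_addr_0.
have sizeE : (size s)%:R = \sum_(v <- undup (map f s)) (mult v)%:R :> R.
  have := sumE (fun=> 1); under [RHS]eq_bigr do rewrite mulr1.
  by rewrite big_const_seq count_predT iter_addr_0.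
have pairE : (\sum_(x <- s) \sum_(y <- s) (f x == f y))%:R =
    \sum_(v <- undup (map f s)) (mult v)%:R ^+ 2 :> R.
  have -> : (\sum_(x <- s) \sum_(y <- s) (f x == f y) = \sum_(x <- s) mult (f x))%N.
    apply: eq_bigr => x _; rewrite /mult count_map -sum1_count [RHS]big_mkcond/=.
    by apply: eq_bigr => y _; rewrite eq_sym; case: eqP.
  rewrite natr_sum (sumE (fun v => (mult v)%:R)).
  by under [RHS]eq_bigr do rewrite expr2.
have -> : (size (undup (map f s)))%:R = \sum_(v <- undup (map f s)) 1 :> R.
  by rewrite big_const_seq count_predT iter_addr_0.
rewrite sizeE pairE !big_distrr/= -sumrB; apply: ler_sum => v _.
by rewrite -subr_ge0 (_ : _ - _ = (1 - t * (mult v)%:R) ^+ 2) ?sqr_ge0//; ring.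
Qed.

Lemma sum_size_undup_map_ge r s (f : I -> T -> E) (B : R) : 0 < B ->
  (\sum_(i <- r) \sum_(x <- s) \sum_(y <- s) (f i x == f i y))%:R <= B ->
  ((size r)%:R * (size s)%:R) ^+ 2 / B <=
    \sum_(i <- r) (size (undup (map (f i) s)))%:R.
Proof.
move=> B0 pairsB; set M := _ %:R * _; pose t := M / B.
apply: (@le_trans _ _ (2 * t * M - t ^+ 2 * B)).
  by rewrite le_eqVlt; apply/orP; left; apply/eqP; rewrite /t; field; rewrite gt_eqF.
apply: (le_trans _ (ler_sum _ (fun i _ => size_undup_map_ge s (f i) t))).
rewrite sumrB big_const_seq count_predT iter_addr_0 -big_distrr/= -natr_sum.
rewrite -[(2 * t * _) *+ _]mulr_natl mulrCA -/M.
by rewrite lerB// ler_wpM2l// sqr_ge0.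
Qed.

End SecondMoment.

Section Trigonometry.
Variable R : realType.
Implicit Types x y s : R.

Lemma is_derive_lipschitz (f df : R -> R) (k : R) :
  (forall x, is_derive x 1 f (df x)) -> (forall x, `|df x| <= k) ->
  forall x y, `|f x - f y| <= k * `|x - y|.
Proof.
move=> fdf dfk x y; wlog xy : x y / x <= y => [lip|].
  by case/orP: (le_total x y) => /lip//; rewrite (distrC (f y)) (distrC y).
have [|c _ fxy] := MVT_segment xy (fun t _ => fdf t).
  by apply: derivable_within_continuous => t _; exact: ex_derive.
by rewrite (distrC (f x)) (distrC x) fxy normrM ler_wpM2r.
Qed.

Lemma sin_lipschitz x y : `|sin x - sin y| <= `|x - y|.
Proof. by rewrite -[leRHS]mul1r; apply: is_derive_lipschitz => t; exact: cos_max. Qed.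

Lemma cos_lipschitz x y : `|cos x - cos y| <= `|x - y|.
Proof.
by rewrite -[leRHS]mul1r; apply: is_derive_lipschitz => t; rewrite normrN sin_max.
Qed.

Lemma normr_sin_le x : `|sin x| <= `|x|.
Proof. by have := sin_lipschitz x 0; rewrite sin0 !subr0. Qed.

Lemma sin_le x : 0 <= x -> sin x <= x.
Proof.
by move=> x0; rewrite -[leRHS]ger0_norm// (le_trans (ler_norm _))// normr_sin_le.
Qed.

Lemma cos_ge x : 1 - x ^+ 2 / 2 <= cos x.
Proof.
have -> : cos x = 1 - 2 * sin (x / 2) ^+ 2.
  rewrite sin2cos2 {1}(_ : x = (x / 2) *+ 2); last by rewrite mulr2n; field.
  by rewrite cos_mulr2n mulr2n; ring.
have : sin (x / 2) ^+ 2 <= (x / 2) ^+ 2.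
  by rewrite -ler_sqrt ?sqr_ge0// !sqrtr_sqr normr_sin_le.
by rewrite exprMn exprVn => h; lra.
Qed.

Lemma sin_ge_half x : 0 <= x <= 1 -> x / 2 <= sin x.
Proof.
move=> /andP[x0 x1].
have [|c] := MVT_segment x0 (fun t _ => is_derive_sin t).
  by apply: continuous_subspaceT; exact: continuous_sin.
rewrite in_itv/= sin0 !subr0 => /andP[c0 cx] ->; rewrite mulrC ler_wpM2r//.
have : c ^+ 2 <= 1 by rewrite exprn_ile1// (le_trans cx).
by have := cos_ge c; lra.
Qed.

Lemma trig_small_angle s : 0 <= s <= 1 / 64 -> 99 / 100 <= cos s /\ 0 <= sin s <= s.
Proof.
move=> /andP[s0 s64]; split.
  have := cos_ge s; have : s ^+ 2 <= (1 / 64) ^+ 2 by rewrite lerXn2r// nnegrE; lra.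
  lra.
by rewrite sin_le// andbT; have := sin_ge_half (x := s); lra.
Qed.

(* The direction of slope 2, in which the projected corners of the squares are
   equally spaced. *)
Definition theta0 : R := atan 2.

Lemma cos_theta0_gt0 : 0 < cos theta0.
Proof. by apply: cos_gt0_pihalf; rewrite atan_gtNpi2 atan_ltpi2. Qed.

Lemma sin_theta0 : sin theta0 = 2 * cos theta0.
Proof.
by have := atanK (2 : R); rewrite /tan => <-; rewrite divfK// gt_eqF// cos_theta0_gt0.
Qed.

Lemma cos_theta0_ge : 44 / 100 <= cos theta0.
Proof.
have := cos2Dsin2 theta0; rewrite sin_theta0 exprMn => cos2.
rewrite -[leLHS]ger0_norm; last lra.
rewrite -[leRHS]ger0_norm; last exact: ltW cos_theta0_gt0.
by rewrite -!sqrtr_sqr ler_sqrt ?sqr_ge0//; lra.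
Qed.

Lemma theta0_itv : 0 <= theta0 <= pi / 2.
Proof.
rewrite /theta0 (ltW (atan_ltpi2 _)) andbT leNgt -oppr_gt0; apply/negP => t0.
have : 0 < sin (- theta0).
  by apply: sin_gt0_pihalf; rewrite t0/= ltrNl atan_gtNpi2.
by rewrite sinN sin_theta0; have := cos_theta0_gt0; lra.
Qed.

Lemma sin_near_theta0 s : 0 <= s <= 1 / 64 -> 8 / 10 <= sin (theta0 + s).
Proof.
move=> /trig_small_angle[c99 /andP[sin_s0 _]].
rewrite sinD sin_theta0; have c44 := cos_theta0_ge.
have := ler_pM _ _ c44 c99; have := mulr_ge0 (ltW cos_theta0_gt0) sin_s0.
by lra.
Qed.

End Trigonometry.

Lemma normr_combination_le (R : numDomainType) (a b c s : R) :
  `|c| <= 1 -> `|s| <= 1 -> `|a * c + b * s| <= `|a| + `|b|.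
Proof.
move=> c1 s1; rewrite (le_trans (ler_normD _ _))// !normrM.
by rewrite lerD// ler_piMr.
Qed.

Section Rotation.
Variable R : realType.
Implicit Types (th s : R) (z w : R * R).

Definition perp th z : R := - z.1 * sin th + z.2 * cos th.

Definition sqr_norm z : R := z.1 ^+ 2 + z.2 ^+ 2.

Definition unit_square : set (R * R) := [set z | 0 <= z.1 <= 1 /\ 0 <= z.2 <= 1].

Lemma projB th z w : proj th (z - w) = proj th z - proj th w.
Proof. by rewrite /proj/=; ring. Qed.

Lemma proj_rotate th s z : proj (th + s) z = proj th z * cos s + perp th z * sin s.
Proof. by rewrite /proj /perp cosD sinD; ring. Qed.

Lemma perp_rotate th s z : perp (th + s) z = perp th z * cos s - proj th z * sin s.
Proof. by rewrite /proj /perp cosD sinD; ring. Qed.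

Lemma proj_sub_angles th s z :
  proj (th + s) z - proj (th - s) z = 2 * sin s * perp th z.
Proof. by rewrite !proj_rotate cosN sinN; ring. Qed.

Lemma dot_proj_perp th z w :
  proj th z * proj th w + perp th z * perp th w = z.1 * w.1 + z.2 * w.2.
Proof.
transitivity ((z.1 * w.1 + z.2 * w.2) * (cos th ^+ 2 + sin th ^+ 2)).
  by rewrite /proj /perp; ring.
by rewrite cos2Dsin2 mulr1.
Qed.

Lemma proj_perp_sqr_norm th z : proj th z ^+ 2 + perp th z ^+ 2 = sqr_norm z.
Proof. by rewrite !expr2 dot_proj_perp. Qed.

Lemma sqr_normB z w :
  sqr_norm z - sqr_norm w = (z - w).1 * (z + w).1 + (z - w).2 * (z + w).2.
Proof. by rewrite /sqr_norm/=; ring. Qed.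

Lemma fst_proj_perp th z : z.1 = proj th z * cos th - perp th z * sin th.
Proof.
transitivity (z.1 * (cos th ^+ 2 + sin th ^+ 2)); first by rewrite cos2Dsin2 mulr1.
by rewrite /proj /perp; ring.
Qed.

Lemma snd_proj_perp th z : z.2 = proj th z * sin th + perp th z * cos th.
Proof.
transitivity (z.2 * (cos th ^+ 2 + sin th ^+ 2)); first by rewrite cos2Dsin2 mulr1.
by rewrite /proj /perp; ring.
Qed.

Lemma normr_proj_le th z : `|proj th z| <= `|z.1| + `|z.2|.
Proof. by rewrite normr_combination_le ?cos_max ?sin_max. Qed.

Lemma normr_perp_le th z : `|perp th z| <= `|z.1| + `|z.2|.
Proof. by rewrite -[in leRHS]normrN normr_combination_le ?cos_max ?sin_max. Qed.

Lemma normr_fst_le th z : `|z.1| <= `|proj th z| + `|perp th z|.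
Proof.
rewrite [in leLHS](fst_proj_perp th) -mulrN.
by rewrite normr_combination_le ?normrN ?cos_max ?sin_max.
Qed.

Lemma normr_snd_le th z : `|z.2| <= `|proj th z| + `|perp th z|.
Proof.
by rewrite [in leLHS](snd_proj_perp th) normr_combination_le ?cos_max ?sin_max.
Qed.

Lemma unit_square_normr z : unit_square z -> `|z.1| + `|z.2| <= 2.
Proof. by case=> /andP[a0 a1] /andP[b0 b1]; rewrite !ger0_norm//; lra. Qed.

Lemma unit_square_proj th z : unit_square z -> `|proj th z| <= 2.
Proof. by move=> /unit_square_normr; exact: le_trans (normr_proj_le _ _). Qed.

Lemma unit_square_perp th z : unit_square z -> `|perp th z| <= 2.
Proof. by move=> /unit_square_normr; exact: le_trans (normr_perp_le _ _). Qed.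

Lemma unit_square_sqr_normB th z w : unit_square z -> unit_square w ->
  `|sqr_norm z - sqr_norm w| <= 4 * (`|proj th (z - w)| + `|perp th (z - w)|).
Proof.
move=> /unit_square_normr z2 /unit_square_normr w2.
have zw4 : `|(z + w).1| + `|(z + w).2| <= 4.
  by have /= := ler_normD z.1 w.1; have /= := ler_normD z.2 w.2; lra.
rewrite sqr_normB -(dot_proj_perp th) (le_trans (ler_normD _ _))// !normrM.
rewrite mulrDr ![4 * _]mulrC lerD// ler_wpM2l// (le_trans _ zw4)//.
  exact: normr_proj_le.
exact: normr_perp_le.
Qed.

Lemma proj_angle_lipschitz th th' z :
  `|proj th z - proj th' z| <= (`|z.1| + `|z.2|) * `|th - th'|.
Proof.
rewrite (_ : _ - _ = z.1 * (cos th - cos th') + z.2 * (sin th - sin th')); last first.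
  by rewrite /proj; ring.
rewrite (le_trans (ler_normD _ _))// !normrM mulrDl.
by rewrite lerD// ler_wpM2l// (cos_lipschitz, sin_lipschitz).
Qed.

End Rotation.

Section Centre.
Variable R : realType.
Implicit Types (r th x S p : R) (z : R * R).

(* The abscissa, along the axis of direction th, of the centre of the circle of
   radius r through z whose centre lies on that axis, on the far side of z. *)
Definition centre r th z : R :=
  proj th z + Num.sqrt (r ^+ 2 - perp th z ^+ 2).

Lemma proj_sigma r th z : `|perp th z| <= 2 ->
  proj th (sigma r th z) = centre r th z - r.
Proof.
move=> small; rewrite /sigma /sigma0 /rotcw /= -/(perp th z) /f_r small.
rewrite /centre /proj /= cosN sinN.
set a := z.1 * cos th + z.2 * sin th; set q := Num.sqrt _.
transitivity ((a - (r - q)) * (cos th ^+ 2 + sin th ^+ 2)); first by ring.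
by rewrite cos2Dsin2; ring.
Qed.

(* p is the centre of a circle of radius r through a point of the unit square
   with projection x and squared norm S. *)
Definition circle_centre r x S p : Prop :=
  [/\ p ^+ 2 - 2 * p * x + S = r ^+ 2, r - 2 <= p - x <= r & -2 <= x <= 2].

Lemma centreP r th z : 2 <= r -> unit_square z ->
  circle_centre r (proj th z) (sqr_norm z) (centre r th z).
Proof.
move=> r2 sz; have y2 := unit_square_perp th sz.
have y4 : perp th z ^+ 2 <= 2 * 2.
  by rewrite -expr2 -real_normK ?num_real// lerXn2r// nnegrE.
have r4 : 0 <= r * (r - 2) by rewrite mulr_ge0; lra.
have ry0 : 0 <= r ^+ 2 - perp th z ^+ 2.
  by rewrite subr_ge0 (le_trans y4)// expr2; lra.
rewrite /circle_centre -(proj_perp_sqr_norm th) -ler_norml unit_square_proj//.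
rewrite /centre; have := sqr_sqrtr ry0; have := sqrtr_ge0 (r ^+ 2 - perp th z ^+ 2).
set q := Num.sqrt _ => q0 qq; split=> //.
  by transitivity (q ^+ 2 + perp th z ^+ 2); [|rewrite qq]; ring.
rewrite [_ + q]addrC addrK.
apply/andP; split; rewrite -(@ler_pXn2r _ 2)// ?nnegrE ?qq.
- by rewrite !expr2 in y4 *; lra.
- lra.
- by have := sqr_ge0 (perp th z); lra.
- lra.
Qed.

Lemma circle_centre_sub r x S p x' S' p' :
  circle_centre r x S p -> circle_centre r x' S' p' ->
  (p - p') * (p + p' - 2 * x) = 2 * p' * (x - x') - (S - S').
Proof.
move=> [e _ _] [e' _ _].
have sub_eq : p ^+ 2 - 2 * p * x + S - (p' ^+ 2 - 2 * p' * x' + S') = 0.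
  by rewrite e e' subrr.
by rewrite -[LHS]subr0 -sub_eq; ring.
Qed.

End Centre.

Section LargeRadius.
Variable R : realType.
Implicit Types (r th d L : R) (z w : R * R).

Lemma centre_ge r th z : 100 <= r -> unit_square z -> r / 2 <= centre r th z.
Proof.
move=> r100; have r2 : 2 <= r by lra.
by move=> /(centreP th r2)[_ /andP[+ _] /andP[+ _]]; lra.
Qed.

Lemma close_centres_proj r th z w d : 100 <= r -> unit_square z -> unit_square w ->
  `|centre r th z - centre r th w| <= d ->
  `|proj th (z - w) - (sqr_norm z - sqr_norm w) / (2 * centre r th w)| <= 2 * d.
Proof.
move=> r100; have r2 : 2 <= r by lra.
move=> /(centreP th r2) cz /(centreP th r2) cw; rewrite projB.
have zw := circle_centre_sub cz cw; case: cz cw => [_ /andP[z1 z2] /andP[z3 z4]].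
move=> [_ /andP[w1 w2] /andP[w3 w4]].
move: (centre r th z) (centre r th w) (proj th z) (proj th w) (sqr_norm z - _)
  zw z1 z2 z3 z4 w1 w2 w3 w4.
move=> p p' x x' Q zw z1 z2 z3 z4 w1 w2 w3 w4 pd.
have p'0 : 0 < 2 * p' by lra.
rewrite (_ : _ - _ = (p - p') * (p + p' - 2 * x) / (2 * p')); last first.
  by rewrite zw; field; rewrite gt_eqF//; lra.
rewrite -mulrA normrM mulrC ler_pM//.
by rewrite ger0_norm ?divr_ge0 ?ler_pdivrMr//; lra.
Qed.

Lemma centre_angle_lipschitz r th th' z : 100 <= r -> unit_square z ->
  `|centre r th z - centre r th' z| <= 3 * `|th - th'|.
Proof.
move=> r100 sz; have r2 : 2 <= r by lra.
have c := centreP th r2 sz; have c' := centreP th' r2 sz.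
have xx' : `|proj th z - proj th' z| <= 2 * `|th - th'|.
  by rewrite (le_trans (proj_angle_lipschitz _ _ _))// ler_wpM2r// unit_square_normr.
have := circle_centre_sub c c'; rewrite subrr subr0.
case: c c' => [_ /andP[z1 z2] /andP[z3 z4]] [_ /andP[z1' z2'] /andP[z3' z4']].
move: (centre r th z) (centre r th' z) z1 z2 z1' z2' => p p' z1 z2 z1' z2'.
move=> /(congr1 (fun t => `|t|)); rewrite !normrM.
rewrite (ger0_norm (_ : 0 <= p + p' - _)); last lra.
rewrite (ger0_norm (_ : 0 <= 2)); last lra.
rewrite (ger0_norm (_ : 0 <= p')); last lra.
move: `|p - p'| `|proj th z - proj th' z| `|th - th'| (normr_ge0 (p - p'))
  (normr_ge0 (proj th z - proj th' z)) (normr_ge0 (th - th')) xx'.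
move=> u v t u0 v0 t0 vt uv.
have rise : u * (2 * r - 8) <= 2 * p' * v by rewrite -uv ler_wpM2l//; lra.
have run : 2 * p' * v <= 2 * (r + 2) * (2 * t) by apply: ler_pM; lra.
have r8 : 0 < 2 * r - 8 by lra.
rewrite -(ler_pM2r r8) (le_trans rise)// (le_trans run)//.
have r16 : 0 <= r - 16 by lra.
by have := mulr_ge0 t0 r16; lra.
Qed.

Lemma centre_rise r th z L : 100 <= r -> 8 / 10 <= sin th -> 0 <= L ->
  unit_square z -> unit_square (z.1, z.2 + L) ->
  centre r th z + L / 2 <= centre r th (z.1, z.2 + L).
Proof.
move=> r100 sin8 L0 sz sz'; have r2 : 2 <= r by lra.
have c := centreP th r2 sz; have c' := centreP th r2 sz'.
have := circle_centre_sub c' c.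
have xx' : proj th (z.1, z.2 + L) - proj th z = L * sin th by rewrite /proj/=; ring.
have xx'_ge0 : 0 <= proj th (z.1, z.2 + L) - proj th z by rewrite xx' mulr_ge0//; lra.
rewrite {}xx'.
have : sqr_norm (z.1, z.2 + L) - sqr_norm z <= 2 * L.
  rewrite (_ : _ - _ = (z.2 + (z.2 + L)) * L); last by rewrite /sqr_norm/=; ring.
  by rewrite ler_wpM2r//; case: sz sz' => _ /andP[_ b1] [_ /= /andP[_ b1']]; lra.
case: c c' => [_ /andP[z1 z2] /andP[z3 z4]] [_ /andP[z1' z2'] /andP[z3' z4']].
set p := centre r th z in z1 z2 *; set p' := centre r th _ in z1' z2' *.
move: (sqr_norm _ - _) => Q Q_le climb.
have run : 0 < p' + p - 2 * proj th (z.1, z.2 + L) by lra.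
rewrite -lerBrDl -(ler_pM2r run) climb.
have gain : (2 * r - 8) * (L * (8 / 10)) <= 2 * p * (L * sin th).
  by apply: ler_pM; [lra|lra|lra|exact: ler_wpM2l].
have lead : L / 2 * (p' + p - 2 * proj th (z.1, z.2 + L)) <= L / 2 * (2 * r).
  by rewrite ler_wpM2l//; lra.
have r_100 : 0 <= r - 100 by lra.
by have := mulr_ge0 L0 r_100; lra.
Qed.

End LargeRadius.

Section CloseCentres.
Variables (R : realType) (z w : R * R) (th d : R).
Hypotheses (sz : unit_square z) (sw : unit_square w).
Implicit Types r s tau : R.

Local Notation U := (proj th (z - w)).
Local Notation W := (perp th (z - w)).

Lemma curvature_le r s tau : 0 < tau -> 100 <= r -> 100 <= r * tau ->
  `|(sqr_norm z - sqr_norm w) / (2 * centre r s w)| <= tau * (`|U| + `|W|) / 25.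
Proof.
move=> tau0 r100 rtau; have pr := centre_ge s r100 sw.
have p0 : 0 < 2 * centre r s w by lra.
rewrite normrM normfV (gtr0_norm p0) ler_pdivrMr//.
apply: (le_trans (unit_square_sqr_normB th sz sw)).
have : 100 <= 2 * centre r s w * tau.
  by rewrite (le_trans rtau)// ler_pM2r//; lra.
move=> /(ler_wpM2l (addr_ge0 (normr_ge0 U) (normr_ge0 W))); lra.
Qed.

(* Up to curvature and rotation by s, proj th (z - w) is the difference of the
   two projections. *)
Lemma proj_le_of_close_centres r s tau :
  0 <= s <= tau -> tau <= 1 / 64 -> 100 <= r * tau ->
  `|centre r (th + s) z - centre r (th + s) w| <= d ->
  `|U| <= 3 * d + 5 / 4 * (tau * `|W|).
Proof.
move=> /andP[s0 stau] tau64 rtau.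
have tau0 : 0 < tau.
  rewrite lt_neqAle (le_trans s0 stau) andbT; apply/eqP => t0; move: rtau.
  by rewrite -t0 mulr0; lra.
have r100 : 100 <= r.
  have r0 : 0 < r by rewrite -(pmulr_lgt0 _ tau0); lra.
  by have := ler_wpM2l (ltW r0) tau64; lra.
move=> /(close_centres_proj r100 sz sw).
have := curvature_le (th + s) tau0 r100 rtau; set Q := _ / (2 * _) => Q_le.
rewrite proj_rotate => close.
have [|c99 /andP[sin0 sin_s]] := @trig_small_angle R s; first lra.
have Ucos : `|U| * cos s <= `|W| * sin s + (2 * d + `|Q|).
  have -> : `|U| * cos s = `|U * cos s|.
    by rewrite normrM (ger0_norm (_ : 0 <= cos s))//; lra.
  have -> : `|W| * sin s = `|W * sin s| by rewrite normrM (ger0_norm sin0).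
  rewrite [in leLHS](_ : U * cos s = (U * cos s + W * sin s - Q) + Q - W * sin s);
    last by ring.
  have := ler_normB (U * cos s + W * sin s - Q + Q) (W * sin s).
  have := ler_normD (U * cos s + W * sin s - Q) Q; lra.
have := ler_wpM2l (normr_ge0 U) c99.
have := ler_wpM2l (normr_ge0 W) (le_trans sin_s stau).
have := ler_wpM2r (normr_ge0 U) tau64.
have := mulr_ge0 (ltW tau0) (normr_ge0 W).
have := normr_ge0 U.
have d0 := le_trans (normr_ge0 _) close.
by move: Ucos Q_le d0; clear; lra.
Qed.

Lemma proj_sub_angles_ge s1 s2 : 0 <= s2 <= s1 -> s1 <= 1 / 64 -> `|U| <= `|W| ->
  48 / 100 * ((s1 - s2) * `|W|) <=
    `|proj (th + s1) (z - w) - proj (th + s2) (z - w)|.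
Proof.
move=> /andP[s20 s21] s164 UW.
set m := (s1 + s2) / 2; set h := (s1 - s2) / 2.
rewrite (_ : th + s1 = th + m + h); last by rewrite /m /h; field.
rewrite (_ : th + s2 = th + m - h); last by rewrite /m /h; field.
have [|c99 /andP[sin0 sin_m]] := @trig_small_angle R m; first by rewrite /m; lra.
have h0 : 0 <= h by rewrite /h; lra.
have sin_h : h <= 2 * sin h.
  have h01 : 0 <= h <= 1 by rewrite /h; lra.
  by have := sin_ge_half h01; lra.
rewrite proj_sub_angles normrM (ger0_norm (_ : 0 <= 2 * sin h)); last lra.
have perp_ge : 96 / 100 * `|W| <= `|perp (th + m) (z - w)|.
  rewrite perp_rotate.
  have : `|W| * cos m - `|U| * sin m <= `|W * cos m - U * sin m|.
    have -> : `|W| * cos m = `|W * cos m|.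
      by rewrite normrM (ger0_norm (_ : 0 <= cos m))//; lra.
    have -> : `|U| * sin m = `|U * sin m| by rewrite normrM (ger0_norm sin0).
    by rewrite lerB_dist.
  have := ler_wpM2l (normr_ge0 W) c99.
  have := ler_wpM2l (normr_ge0 U) (_ : sin m <= 1 / 64); rewrite /m in sin_m *.
  by have := normr_ge0 U; lra.
have := ler_pM h0 _ sin_h perp_ge; rewrite /h; have := normr_ge0 W; lra.
Qed.

Lemma curvature_sub_angles_le r s1 s2 : 100 <= r -> 0 <= s2 <= s1 -> `|U| <= `|W| ->
  `|(sqr_norm z - sqr_norm w) / (2 * centre r (th + s1) w) -
    (sqr_norm z - sqr_norm w) / (2 * centre r (th + s2) w)| <=
  1 / 100 * ((s1 - s2) * `|W|).
Proof.
move=> r100 /andP[s20 s21] UW.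
have := unit_square_sqr_normB th sz sw.
have := centre_angle_lipschitz (th + s1) (th + s2) r100 sw.
have := centre_ge (th + s1) r100 sw; have := centre_ge (th + s2) r100 sw.
rewrite (_ : th + s1 - (th + s2) = s1 - s2); last by ring.
rewrite (ger0_norm (_ : 0 <= s1 - s2)); last lra.
move: (centre r (th + s1) w) (centre r (th + s2) w) (sqr_norm z - sqr_norm w).
move=> p1 p2 Q rp2 rp1 p12 QUW.
have p1_gt0 : 0 < p1 by lra.
have p2_gt0 : 0 < p2 by lra.
have pp : 50 * 50 <= p1 * p2 by apply: ler_pM; lra.
have pp0 : 0 < 2 * (p1 * p2) by rewrite !mulr_gt0.
rewrite (_ : Q / _ - _ = Q * (p2 - p1) / (2 * (p1 * p2))); last first.
  by field; rewrite !gt_eqF.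
rewrite normrM normfV (gtr0_norm pp0) ler_pdivrMr// normrM distrC.
have Q8 : `|Q| <= 8 * `|W| by lra.
have := ler_pM (normr_ge0 _) (normr_ge0 _) Q8 p12.
have sW0 : 0 <= (s1 - s2) * `|W| by rewrite mulr_ge0// subr_ge0.
by have := ler_wpM2l sW0 pp; lra.
Qed.

Lemma close_centres_angles_le r s1 s2 :
  100 <= r -> 0 <= s2 <= s1 -> s1 <= 1 / 64 -> `|U| <= `|W| ->
  `|centre r (th + s1) z - centre r (th + s1) w| <= d ->
  `|centre r (th + s2) z - centre r (th + s2) w| <= d ->
  (s1 - s2) * `|W| <= 9 * d.
Proof.
move=> r100 s12 s164 UW.
move=> /(close_centres_proj r100 sz sw) c1 /(close_centres_proj r100 sz sw) c2.
have := proj_sub_angles_ge s12 s164 UW; have := curvature_sub_angles_le r100 s12 UW.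
set x1 := proj (th + s1) _ in c1 *; set x2 := proj (th + s2) _ in c2 *.
set q1 := _ / (2 * _) in c1 *; set q2 := _ / (2 * _) in c2 *.
rewrite (_ : x1 - x2 = (x1 - q1) + ((q1 - q2) - (x2 - q2))); last by ring.
have := ler_normD (x1 - q1) ((q1 - q2) - (x2 - q2)).
have := ler_normB (q1 - q2) (x2 - q2).
have d0 := le_trans (normr_ge0 _) c1.
by move: c1 c2 d0; clear; lra.
Qed.

End CloseCentres.

Section CantorSquares.
Variable R : realType.
Implicit Types a b : R.

Lemma cantor_left_num bit n m : cantor_left n ((cantor_num bit n m)%:R / 4 ^+ n : R).
Proof.
elim: n m => [|n ih] m /=; first by rewrite mul0r.
exists ((cantor_num bit n (m %/ 4)%N)%:R / 4 ^+ n); first exact: ih.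
have n0 : (4 ^+ n : R) != 0 by rewrite expf_neq0// pnatr_eq0.
by rewrite natrD !natrM !exprS; case: (bit _) => /=; [right|left]; field.
Qed.

Lemma cantor_left_itv n a : cantor_left n a -> 0 <= a <= 1 - 4 ^- n.
Proof.
elim: n a => [|n ih] a /=; first by move=> ->; rewrite expr0 invr1 subrr lexx.
case=> b /ih/andP[b0 b1]; have : 4 ^- n = 4 * 4 ^- n.+1 :> R.
  by rewrite exprS invfM mulVKf.
have : 0 <= 4 ^- n.+1 :> R by rewrite invr_ge0 exprn_ge0.
by move: (4 ^- n.+1 : R) => q q0 nq [] ->; apply/andP; split; lra.
Qed.

Lemma cantorK_unit_square n : cantorK n `<=` @unit_square R.
Proof.
have cantorC_itv (x : R) : cantorC n x -> 0 <= x <= 1.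
  move=> [a /cantor_left_itv/andP[a0 a1]]; rewrite /= in_itv/= => /andP[ax xa].
  by apply/andP; split; lra.
by move=> z [/cantorC_itv z1 /cantorC_itv z2].
Qed.

Definition corner n m : R * R :=
  ((xnum n m)%:R / 4 ^+ n, (ynum n m)%:R / 4 ^+ n).

Lemma cantorK_square n m a b : 0 <= a <= 4 ^- n -> 0 <= b <= 4 ^- n ->
  cantorK n ((corner n m).1 + a, (corner n m).2 + b).
Proof.
have cantorC_num bit c : 0 <= c <= 4 ^- n ->
    cantorC n ((cantor_num bit n m)%:R / 4 ^+ n + c : R).
  move=> /andP[c0 c1]; exists ((cantor_num bit n m)%:R / 4 ^+ n).
    exact: cantor_left_num.
  by rewrite /= in_itv/= lerDl c0 lerD2l.
by move=> a01 b01; split; exact: cantorC_num.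
Qed.

Lemma cantorK_corner n m : cantorK n (corner n m).
Proof.
have := @cantorK_square n m 0 0; rewrite !addr0 -surjective_pairing lexx.
by rewrite invr_ge0 exprn_ge0//; exact.
Qed.

Lemma corner_unit_square n m : unit_square (corner n m).
Proof. exact: cantorK_unit_square (cantorK_corner n m). Qed.

End CantorSquares.

Arguments corner {R}.

Section Shadow.
Variable R : realType.
Implicit Types (r th L y : R) (E : set (R * R)).

Definition shadow r th E : set R := proj th @` (sigma r th @` E).

Lemma continuous_centre r th : continuous (centre r th).
Proof.
move=> z; have lin (a b : R) :
    (fun u : R * R => u.1 * a + u.2 * b) @ z --> z.1 * a + z.2 * b.
  by apply: cvgD; apply: cvgMr_tmp; [exact: cvg_fst|exact: cvg_snd].
rewrite /centre /proj; apply: cvgD; first exact: lin.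
apply: continuous_cvg; first exact: sqrt_continuous.
have perpE u : perp th u = u.1 * (- sin th) + u.2 * cos th.
  by rewrite /perp mulNr mulrN.
apply: cvgB; first exact: cvg_cst.
by under eq_fun do rewrite perpE expr2; rewrite perpE expr2; apply: cvgM; exact: lin.
Qed.

Lemma shadow_path r th E (gamma : R -> R * R) L y : E `<=` @unit_square R ->
  0 <= L -> continuous gamma -> (forall t, 0 <= t <= L -> E (gamma t)) ->
  centre r th (gamma 0) <= y + r <= centre r th (gamma L) -> shadow r th E y.
Proof.
move=> Esq L0 cgamma Egamma /andP[y1 y2].
have [||t] := @IVT R (centre r th \o gamma) 0 L (y + r) L0.
- apply: continuous_subspaceT => t.
  by apply: continuous_comp; [exact: cgamma|exact: continuous_centre].
- by rewrite /= ge_min y1 le_max y2 orbT.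
rewrite in_itv/= => /Egamma Et ct.
exists (sigma r th (gamma t)); first by exists (gamma t).
by rewrite proj_sigma ?ct ?addrK//; exact/unit_square_perp/Esq.
Qed.

(* The left edge of the square, followed upwards. *)
Lemma shadow_square r th n m y : 100 <= r -> 8 / 10 <= sin th ->
  centre r th (corner n m) <= y + r <= centre r th (corner n m) + 4 ^- n / 2 ->
  shadow r th (cantorK n) y.
Proof.
move=> r100 sin8 /andP[y1 y2].
have n0 : 0 <= 4 ^- n :> R by rewrite invr_ge0 exprn_ge0.
have edge (t : R) : 0 <= t <= 4 ^- n ->
    cantorK n ((corner n m).1, (corner n m).2 + t).
  move=> t_itv; rewrite -[X in (X, _)]addr0.
  by apply: cantorK_square; rewrite // lexx.
apply: (shadow_path _ n0 _ edge); first exact: cantorK_unit_square.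
  move=> t; have up : (fun t : R => (corner n m).2 + t) @ t --> (corner n m).2 + t.
    by apply: cvgD; [exact: cvg_cst|exact: cvg_id].
  exact: (cvg_pair (cvg_cst _) up).
rewrite addr0 -surjective_pairing y1 (le_trans y2)//.
apply: centre_rise => //; first exact: corner_unit_square.
by apply: (@cantorK_unit_square _ n); apply: edge; rewrite n0 lexx.
Qed.

End Shadow.

Section Cells.
Variable R : realType.
Implicit Types (r th : R) (n m i : nat).

Definition angle_step n : R := 4 ^- n / 64.

Definition angle n i : R := theta0 R + i%:R * angle_step n.

Definition cell_width n : R := 4 ^- n / 8.

(* The shift by 2 makes the cell lie inside the projection of the whole square,
   for every direction between [angle n i] and [angle n i.+1]. *)
Definition cell_index r n i m : int :=
  Num.floor (centre r (angle n i) (corner n m) / cell_width n) + 2.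

Definition cells r n i : seq int :=
  undup [seq cell_index r n i m | m <- index_iota 0 (4 ^ n)].

Lemma inv_exp4_gt0 n : 0 < 4 ^- n :> R.
Proof. by rewrite invr_gt0 exprn_gt0. Qed.

Lemma angle_step_gt0 n : 0 < angle_step n.
Proof. by rewrite divr_gt0// inv_exp4_gt0. Qed.

Lemma cell_width_gt0 n : 0 < cell_width n.
Proof. by rewrite divr_gt0// inv_exp4_gt0. Qed.

Lemma sin_angle_ge n i th : (i < 4 ^ n)%N -> angle n i <= th <= angle n i.+1 ->
  8 / 10 <= sin th.
Proof.
move=> iN /andP[th1 th2]; rewrite (_ : th = theta0 R + (th - theta0 R)); last by ring.
have i0 : 0 <= i%:R * angle_step n by rewrite mulr_ge0// ltW// angle_step_gt0.
have i1 : i.+1%:R * angle_step n <= 1 / 64.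
  rewrite mulrA ler_pM2r// ler_pdivrMr ?exprn_gt0// mul1r.
  by rewrite -natrX ler_nat.
by apply: sin_near_theta0; move: th1 th2; rewrite /angle; lra.
Qed.

Lemma cell_shadow r n i m th : 100 <= r -> (i < 4 ^ n)%N ->
  angle n i <= th <= angle n i.+1 ->
  grid_cell (- r) (cell_width n) (cell_index r n i m) `<=` shadow r th (cantorK n).
Proof.
move=> r100 iN th_itv y; rewrite /grid_cell/= in_itv/= -!lerBrDl -!ltrBlDl opprK.
have w0 := cell_width_gt0 n.
rewrite /cell_index !intrD.
have := floor_itv (centre r (angle n i) (corner n m) / cell_width n).
set c := centre r _ _; rewrite intrD ler_pdivlMr// ltr_pdivrMr//.
move: (_%:~R) => v /andP[v1 v2] /andP[y1 y2].
have drift : `|centre r th (corner n m) - c| <= 3 * angle_step n.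
  rewrite (le_trans (centre_angle_lipschitz _ _ r100 (corner_unit_square R n m)))//.
  rewrite ler_pM2l// ger0_norm; last by move: th_itv; lra.
  by move: th_itv; rewrite /angle -natr1; lra.
apply: (@shadow_square _ _ _ _ m) => //; first exact: sin_angle_ge th_itv.
move: drift v1 v2 y1 y2 w0; rewrite ler_norml /angle_step /cell_width.
by move: (4 ^- n : R) => u /andP[d1 d2] v1 v2 y1 y2 w0; apply/andP; split; lra.
Qed.

Lemma shadow_measure_ge r n i th : 100 <= r -> (i < 4 ^ n)%N ->
  angle n i <= th <= angle n i.+1 ->
  (((size (cells r n i))%:R * cell_width n)%:E <=
     lebesgue_measure (shadow r th (cantorK n)))%E.
Proof.
move=> r100 iN th_itv; apply: (@lebesgue_measure_grid_cells_ge _ (- r)).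
- exact: cell_width_gt0.
- exact: undup_uniq.
by move=> v; rewrite mem_undup => /mapP[m _ ->]; exact: cell_shadow th_itv.
Qed.

End Cells.

Arguments angle_step {R}.
Arguments angle {R}.
Arguments cell_width {R}.

Lemma natr_distn (R : numDomainType) (m m' : nat) :
  `|m - m'|%N%:R = `|m%:R - m'%:R| :> R.
Proof. by rewrite natr_absz intr_norm intrB. Qed.

Section CornerGaps.
Variable R : realType.
Implicit Types (n l m : nat) (th : R).

Lemma corner_sub n m m' : corner n m - corner n m' =
  (((xnum n m)%:R - (xnum n m')%:R) * 4 ^- n,
   ((ynum n m)%:R - (ynum n m')%:R) * 4 ^- n) :> R * R.
Proof. by congr pair; rewrite /= mulrBl. Qed.

Lemma proj_theta0_corner_sub n m m' : (m < 4 ^ n)%N -> (m' < 4 ^ n)%N ->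
  proj (theta0 R) (corner n m - corner n m') =
  3 * cos (theta0 R) * (m%:R - m'%:R) * 4 ^- n :> R.
Proof.
have index k : (k < 4 ^ n)%N -> (xnum n k)%:R + 2 * (ynum n k)%:R = 3 * k%:R :> R.
  by move=> kn; rewrite -!natrM -natrD xnum_ynum.
move=> /index e /index e'; rewrite corner_sub /proj sin_theta0/=.
transitivity (cos (theta0 R) * 4 ^- n *
  ((xnum n m)%:R + 2 * (ynum n m)%:R - ((xnum n m')%:R + 2 * (ynum n m')%:R))).
  by ring.
by rewrite e e'; ring.
Qed.

Lemma normr_perp_corner_sub th n l m m' :
  (l <= n)%N -> (m %/ 4 ^ l = m' %/ 4 ^ l)%N ->
  `|perp th (corner n m - corner n m')| <= 2 * 4 ^+ l * 4 ^- n.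
Proof.
move=> ln e; rewrite (le_trans (normr_perp_le _ _))// corner_sub/= !normrM.
have n0 : 0 <= 4 ^- n :> R := ltW (inv_exp4_gt0 R n).
rewrite [`|4 ^- n|]ger0_norm// -mulrDl ler_wpM2r//.
have block bit : `|(cantor_num bit n m)%:R - (cantor_num bit n m')%:R| <= 4 ^+ l :> R.
  by rewrite -natr_distn -natrX ler_nat ltnW// cantor_num_block.
by rewrite mulr_natl mulr2n lerD// block.
Qed.

Lemma proj_perp_corner_sub_ge th n l m m' : (l < n)%N -> splits_at l m m' ->
  2 * 4 ^+ l * 4 ^- n <= `|proj th (corner n m - corner n m')| +
                         `|perp th (corner n m - corner n m')|.
Proof.
move=> ln /(split_far ln) far.
have far_le (a b : nat) : (2 * 4 ^ l < `|a - b|)%N ->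
    2 * 4 ^+ l * 4 ^- n <= `|(a%:R - b%:R) * 4 ^- n| :> R.
  move=> ab; rewrite normrM [`|4 ^- n|]ger0_norm ?invr_ge0 ?exprn_ge0//.
  by rewrite ler_wpM2r ?invr_ge0 ?exprn_ge0// -natr_distn -natrX -natrM ler_nat ltnW.
case: far => /far_le far; apply: (le_trans far).
  by have := normr_fst_le th (corner n m - corner n m'); rewrite [in leLHS]corner_sub.
by have := normr_snd_le th (corner n m - corner n m'); rewrite [in leLHS]corner_sub.
Qed.

End CornerGaps.

Section Collisions.
Variables (R : realType) (r : R) (n j : nat).
Hypotheses (j3n : (3 <= j <= n)%N) (r_ge_exp4 : 100 * 4 ^+ j <= r).
Implicit Types (l m i : nat).

Local Notation gap m m' := (corner n m - corner n m').

Definition same_cell i : rel nat :=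
  fun m m' => cell_index r n i m == cell_index r n i m'.

Let inv_exp4_le : 4 ^- j <= 1 / 64 :> R.
Proof.
have /andP[j3 _] := j3n; rewrite div1r lef_pV2 ?posrE ?exprn_gt0//.
by rewrite (_ : 64 = 4 ^+ 3); [rewrite ler_eXn2l// ltr1n|ring].
Qed.

Let r_ge100 : 100 <= r.
Proof.
have : 1 <= 4 ^+ j :> R by rewrite exprn_ege1// ler1n.
by move: r_ge_exp4; lra.
Qed.

Lemma sector_angle i : (i < 4 ^ (n - j + 3))%N ->
  0 <= i%:R * (angle_step n : R) <= 4 ^- j.
Proof.
have /andP[_ jn] := j3n => i_lt.
rewrite mulr_ge0 ?(ltW (angle_step_gt0 R n))//= mulrA !ler_pdivrMr ?exprn_gt0//.
have -> : 4 ^- j * 64 * 4 ^+ n = 4 ^+ (n - j + 3) :> R.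
  rewrite -[in LHS](subnK jn) !exprD; field.
  by rewrite expf_neq0// pnatr_eq0.
by rewrite -natrX ler_nat ltnW.
Qed.

Lemma same_cell_centres i m m' : same_cell i m m' ->
  `|centre r (angle n i) (corner n m) - centre r (angle n i) (corner n m')|
    <= cell_width n.
Proof.
by move=> /eqP/addIr; apply: floor_div_eq_close; exact: cell_width_gt0.
Qed.

Lemma same_cell_proj i m m' : (i < 4 ^ (n - j + 3))%N -> same_cell i m m' ->
  `|proj (theta0 R) (gap m m')| <=
    3 * cell_width n + 5 / 4 * (4 ^- j * `|perp (theta0 R) (gap m m')|).
Proof.
move=> /sector_angle i_itv /same_cell_centres.
apply: proj_le_of_close_centres => //; try exact: corner_unit_square.
by rewrite ler_pdivlMr ?exprn_gt0.
Qed.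

Lemma same_cell_close l m m' i : (l < n)%N -> (m < 4 ^ n)%N -> (m' < 4 ^ n)%N ->
  splits_at l m m' -> (i < 4 ^ (n - j + 3))%N -> same_cell i m m' ->
  (`|m - m'| <= 3 * 4 ^ (l.+1 - j))%N.
Proof.
move=> ln mn m'n /andP[/eqP block _] i_lt /(same_cell_proj i_lt) U_le.
have u0 : 0 < 4 ^- n :> R := inv_exp4_gt0 R n.
have q0 : 0 <= 4 ^- j :> R by rewrite invr_ge0 exprn_ge0.
have W_le := ler_wpM2l q0 (normr_perp_corner_sub (theta0 R) ln block).
have reach : 4 ^- j * (2 * 4 ^+ l.+1) <= 2 * 4 ^+ (l.+1 - j) :> R.
  rewrite mulrCA ler_pM2l// mulrC ler_pdivrMr ?exprn_gt0// -exprD.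
  by rewrite ler_eXn2l ?ltr1n//; lia.
have close : 3 * cos (theta0 R) * `|m - m'|%N%:R <= 3 / 8 + 5 / 2 * 4 ^+ (l.+1 - j).
  rewrite -(ler_pM2r u0); have := ler_wpM2r (ltW u0) reach; move: U_le W_le.
  rewrite proj_theta0_corner_sub// !normrM [`|4 ^- n|]gtr0_norm// -natr_distn.
  rewrite (gtr0_norm (cos_theta0_gt0 R)) (ger0_norm (_ : 0 <= 3))// /cell_width.
  by lra.
have one : 1 <= 4 ^+ (l.+1 - j) :> R by rewrite exprn_ege1// ler1n.
rewrite -(ler_nat R) natrM natrX.
have := ler_wpM2r (ler0n R `|m - m'|) (cos_theta0_ge R).
by lra.
Qed.

Lemma same_cell_angles l m m' i i' : (l < n)%N -> splits_at l m m' ->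
  (i < 4 ^ (n - j + 3))%N -> (i' < 4 ^ (n - j + 3))%N ->
  same_cell i m m' -> same_cell i' m m' -> (`|i - i'| <= 64 * 4 ^ (n - l))%N.
Proof.
move=> ln split; wlog ii' : i i' / (i' <= i)%N => [wlog_le|].
  by case/orP: (leq_total i' i) => /wlog_le// h *; rewrite distnC; exact: h.
move=> i_lt i'_lt coll coll'; have U_le := same_cell_proj i_lt coll.
have UW := proj_perp_corner_sub_ge (theta0 R) ln split.
have u0 : 0 < 4 ^- n :> R := inv_exp4_gt0 R n.
have l1 : 1 <= 4 ^+ l :> R by rewrite exprn_ege1// ler1n.
have W_ge : 3 / 2 * (4 ^+ l * 4 ^- n) <= `|perp (theta0 R) (gap m m')|.
  have := ler_wpM2r (normr_ge0 (perp (theta0 R) (gap m m'))) inv_exp4_le.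
  by have := ler_wpM2r (ltW u0) l1; move: U_le UW; rewrite /cell_width; lra.
have U_le_W : `|proj (theta0 R) (gap m m')| <= `|perp (theta0 R) (gap m m')|.
  have := ler_wpM2r (normr_ge0 (perp (theta0 R) (gap m m'))) inv_exp4_le.
  by have := ler_wpM2r (ltW u0) l1; move: U_le; rewrite /cell_width; lra.
have ii'_ge0 : 0 <= i%:R - i'%:R :> R by rewrite subr_ge0 ler_nat.
have step0 := angle_step_gt0 R n.
have := close_centres_angles_le (corner_unit_square R n m) (corner_unit_square R n m')
  r_ge100 _ _ U_le_W (same_cell_centres coll) (same_cell_centres coll').
have spread0 := mulr_ge0 ii'_ge0 (ltW step0).
rewrite -mulrBl => /(_ _ _)/(le_trans (ler_wpM2l spread0 W_ge)).
have [/andP[_ s1] /andP[s2 _]] := (sector_angle i_lt, sector_angle i'_lt).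
rewrite s2 ler_pM2r// ler_nat ii' (le_trans s1 inv_exp4_le) => /(_ isT isT) spread.
rewrite -(ler_nat R) natr_distn ger0_norm// natrM natrX.
rewrite -(ler_pM2r (lt_le_trans ltr01 l1)) -mulrA -exprD subnK; last exact: ltnW.
rewrite -ler_pdivrMr ?exprn_gt0// -(ler_pM2r u0).
by move: spread; rewrite /angle_step /cell_width; lra.
Qed.

Definition collision_constant : nat := 7 * 4 ^ 3 + 672 * (2 * 64 + 1).

Lemma sum_same_cell_le : (4 ^ j <= n)%N ->
  (\sum_(i < 4 ^ (n - j + 3)) \sum_(m < 4 ^ n) \sum_(m' < 4 ^ n) same_cell i m m' <=
   collision_constant * (n * 4 ^ (2 * (n - j))))%N.
Proof.
have /andP[_ jn] := j3n => j4.
apply: leq_trans (sum_collisions_le (D := 64) same_cell_close same_cell_angles) _.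
rewrite /collision_constant mulnDl leq_add//; last by rewrite mulnCA.
have -> : (7 * 4 ^ n * 4 ^ (n - j + 3) = 7 * 4 ^ 3 * (4 ^ j * 4 ^ (2 * (n - j))))%N.
  by rewrite -!mulnA -!expnD -!expnS; congr (_ * 4 ^ _)%N; lia.
by rewrite leq_mul2l leq_mul2r j4 orbT.
Qed.

End Collisions.

Section FavardRings.
Variable R : realType.
Implicit Types (r : R) (n J i j : nat).

Lemma Fav_ge_grid (T : R -> R * R -> R * R) E (K : nat) (c : nat -> R) (a d : R) :
  0 < d -> 0 <= a -> a + K%:R * d <= 2 * pi -> (forall i, 0 <= c i) ->
  (forall i (th : R), (i < K)%N -> a + i%:R * d <= th <= a + i.+1%:R * d ->
     ((c i)%:E <= lebesgue_measure (proj th @` (T th @` E)))%E) ->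
  (((2 * pi)^-1 * (d * \sum_(i < K) c i))%:E <= Fav T E)%E.
Proof.
move=> d0 a0 aK c0 cT; rewrite /Fav EFinM.
apply: lee_wpmul2l; first by rewrite lee_fin invr_ge0 mulr_ge0// pi_ge0.
have cell_itv i th : grid_cell a d i th -> a + i%:R * d <= th < a + i.+1%:R * d.
  by rewrite /grid_cell/= in_itv/= -[(_ + 1)%:~R]/((i + 1)%N%:R) addn1.
apply: (@integral_grid_ge _ a) => //.
- move=> i iK th /cell_itv/andP[th1 th2]; rewrite /= in_itv/=.
  have i0 : 0 <= i%:R * d by rewrite mulr_ge0// ltW.
  have iK' : i.+1%:R * d <= K%:R * d by rewrite ler_pM2r// ler_nat.
  by apply/andP; split; lra.
- by move=> i th iK /cell_itv/andP[th1 th2]; apply: cT; rewrite // th1 ltW.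
Qed.

Definition ring_cells_lower_bound n : R :=
  48 ^+ 2 * (4 ^+ n) ^+ 2 / (collision_constant%:R * n%:R).

Lemma collision_constant_gt0 : 0 < collision_constant%:R :> R.
Proof. by rewrite ltr0n /collision_constant addn_gt0. Qed.

(* The ring of index j consists of the angles theta0 + s with 4^-j / 4 <= s < 4^-j. *)
Lemma ring_cells_ge r n j : (3 <= j)%N -> (4 ^ j <= n)%N -> 100 * n%:R <= r ->
  ring_cells_lower_bound n <=
    \sum_(4 ^ (n - j + 2) <= i < 4 ^ (n - j + 3)) (size (cells r n i))%:R.
Proof.
move=> j3 j4 rn; have jn : (j <= n)%N by rewrite (leq_trans _ j4)// ltnW// ltn_expl.
have rj : 100 * 4 ^+ j <= r by rewrite (le_trans _ rn)// ler_pM2l// -natrX ler_nat.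
have n0 : 0 < n%:R :> R by rewrite ltr0n (leq_trans _ jn)// (leq_trans _ j3).
pose B : R := (collision_constant * (n * 4 ^ (2 * (n - j))))%N%:R.
have pairs : (\sum_(4 ^ (n - j + 2) <= i < 4 ^ (n - j + 3))
    \sum_(0 <= m < 4 ^ n) \sum_(0 <= m' < 4 ^ n) same_cell r n i m m')%:R <= B.
  have j3n : (3 <= j <= n)%N by rewrite j3.
  rewrite ler_nat; apply: leq_trans (sum_same_cell_le j3n rj j4).
  rewrite -(big_mkord xpredT
    (fun i => \sum_(m < 4 ^ n) \sum_(m' < 4 ^ n) same_cell r n i m m')%N).
  rewrite [leqRHS](@big_cat_nat _ _ _ (4 ^ (n - j + 2)))//=; last first.
    by rewrite leq_pexp2l// leq_add2l.
  rewrite (leq_trans _ (leq_addl _ _))//; apply: leq_sum => i _.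
  by rewrite big_mkord; apply: leq_sum => m _; rewrite big_mkord.
have B0 : 0 < B.
  by rewrite /B !natrM natrX !mulr_gt0 ?exprn_gt0// collision_constant_gt0.
apply: le_trans (sum_size_undup_map_ge B0 pairs).
rewrite !size_iota subn0 (_ : 4 ^ (n - j + 3) - _ = 48 * 4 ^ (n - j))%N; last first.
  by rewrite !expnD; lia.
rewrite /B /ring_cells_lower_bound mulnC mul2n -addnn expnD !natrM !natrX.
rewrite le_eqVlt; apply/orP; left; apply/eqP; field.
by rewrite !gt_eqF ?exprn_gt0 ?collision_constant_gt0.
Qed.

Lemma cells_sum_ge r n J : (4 ^ J <= n)%N -> 100 * n%:R <= r ->
  (J - 2)%:R * ring_cells_lower_bound n <= \sum_(i < 4 ^ n) (size (cells r n i))%:R.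
Proof.
move=> Jn rn; have [J2|J2] := leqP J 2; first by rewrite (eqP J2) mul0r sumr_ge0.
have J_le_n : (J <= n)%N by rewrite (leq_trans _ Jn)// ltnW// ltn_expl.
rewrite -(big_mkord xpredT (fun i => (size (cells r n i))%:R)).
rewrite [leRHS](@big_cat_nat _ _ _ (4 ^ (n - J + 2)))//=; last first.
  by rewrite leq_pexp2l//; lia.
rewrite (@big_nat_telescope _ _ (expn 4)); [|by move=> k; rewrite leq_exp2l|lia].
apply: ler_wpDl; first by rewrite sumr_ge0.
have -> : (J - 2)%:R * ring_cells_lower_bound n =
    \sum_(n - J + 2 <= k < n) ring_cells_lower_bound n.
  by rewrite mulr_natl sumr_const_nat; congr (_ *+ _); lia.
apply: ler_sum_nat => k /andP[k1 k2].
have := @ring_cells_ge r n (n + 2 - k); rewrite (_ : n - _ + 2 = k)%N; last lia.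
rewrite (_ : n - _ + 3 = k.+1)%N; last lia.
by apply=> //; [lia|rewrite (leq_trans _ Jn)// leq_pexp2l//; lia].
Qed.

Lemma Fav_cantorK_ge_rings : exists2 c : R, 0 < c & forall r n J,
  (0 < n)%N -> (4 ^ J <= n)%N -> 100 * n%:R <= r ->
  ((c * (J - 2)%:R / n%:R)%:E <= Fav (sigma r) (cantorK n))%E.
Proof.
have C0 := collision_constant_gt0.
have pi2 : 0 < 2 * pi :> R by rewrite mulr_gt0// pi_gt0.
exists ((2 * pi)^-1 * (48 ^+ 2 / (64 * 8 * collision_constant%:R))).
  by rewrite mulr_gt0 ?invr_gt0// divr_gt0 ?exprn_gt0 ?mulr_gt0.
move=> r n J n1 Jn rn; have n0 : 1 <= n%:R :> R by rewrite ler1n.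
have r100 : 100 <= r by lra.
have step0 := angle_step_gt0 R n.
have [th0 thpi] := andP (theta0_itv R).
have range : theta0 R + (4 ^ n)%:R * angle_step n <= 2 * pi.
  rewrite natrX /angle_step mulrA mulfV ?expf_neq0 ?pnatr_eq0//.
  by have := pi_ge2 R; lra.
apply: le_trans (@Fav_ge_grid (sigma r) (cantorK n) (4 ^ n)
  (fun i => (size (cells r n i))%:R * cell_width n) _ _ step0 th0 range _ _);
  last 2 first.
- by move=> i; rewrite mulr_ge0// ltW// cell_width_gt0.
- by move=> i th iN th_itv; exact: shadow_measure_ge.
rewrite lee_fin -mulr_suml; apply: (@le_trans _ _ ((2 * pi)^-1 *
    (angle_step n * ((J - 2)%:R * ring_cells_lower_bound n * cell_width n))));
  last first.
  by rewrite !ler_pM2l ?invr_gt0// ler_pM2r ?cell_width_gt0// cells_sum_ge.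
rewrite le_eqVlt; apply/orP; left; apply/eqP.
rewrite /angle_step /cell_width /ring_cells_lower_bound; field.
by rewrite !gt_eqF ?exprn_gt0 ?pi_gt0//; lra.
Qed.

Lemma Fav_cantorK_ge_log : exists2 c : R, 0 < c &
  \forall n \near \oo, forall r, 100 * n%:R <= r ->
    ((c * ln n%:R / n%:R)%:E <= Fav (sigma r) (cantorK n))%E.
Proof.
have [c c0 Fav_ge] := Fav_cantorK_ge_rings.
have ln4 : 0 < ln 4 :> R by rewrite ln_gt0// ltr1n.
exists (c / (4 * ln 4)); first by rewrite divr_gt0// mulr_gt0.
exists (4 ^ 3)%N => // n /= n64 r rn.
have n0 : (0 < n)%N by rewrite (leq_trans _ n64).
have /andP[Jn nJ] := trunc_log_bounds (isT : 1 < 4)%N n0.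
have J3 : (3 <= trunc_log 4 n)%N by rewrite trunc_log_max.
apply: le_trans (Fav_ge r n _ n0 Jn rn); rewrite lee_fin ler_pM2r ?invr_gt0 ?ltr0n//.
have ln_le : ln n%:R <= (trunc_log 4 n).+1%:R * ln 4 :> R.
  by rewrite mulr_natl -lnXn// ler_ln ?posrE ?exprn_gt0 ?ltr0n// -natrX ler_nat ltnW.
rewrite -mulrA ler_pM2l// mulrC ler_pdivrMr ?mulr_gt0// (le_trans ln_le)//.
by rewrite mulrA ler_pM2r// -natrM ler_nat; lia.
Qed.

End FavardRings.

Lemma sqrt_sub_sqr_ge (R : rcfType) (r u : R) :
  0 <= u <= r -> r - u <= Num.sqrt (r ^+ 2 - u ^+ 2).
Proof.
move=> /andP[u0 ur]; rewrite -[leLHS]ger0_norm ?subr_ge0// -sqrtr_sqr ler_wsqrtr//.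
have ru0 : 0 <= r - u by rewrite subr_ge0.
by have := mulr_ge0 u0 ru0; rewrite !expr2; lra.
Qed.

Section FavardFirstSquare.
Variable R : realType.
Implicit Types (r th L : R) (E : set (R * R)).

(* Along a horizontal edge the projection moves at speed at least
   cos th - sin th >= 1 / 2. *)
Lemma shadow_horizontal_edge r th L E : 1 <= r -> 0 <= th <= 1 / 4 -> 0 <= L <= 1 ->
  E `<=` @unit_square R -> (forall t, 0 <= t <= L -> E (t, 0)) ->
  `[0, L / 2]%classic `<=` shadow r th E.
Proof.
move=> r1 /andP[th0 th4] /andP[L0 L1] Esq edge y; rewrite /= in_itv/= => /andP[y0 yL].
apply: (shadow_path Esq L0 _ edge).
  by move=> t; exact: (cvg_pair cvg_id (cvg_cst _)).
rewrite /centre /proj /perp/= !(mul0r, mulr0, oppr0, addr0) expr0n subr0 sqrtr_sqr.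
rewrite (ger0_norm (_ : 0 <= r)) ?(add0r, lerDr) ?y0/=; last lra.
have sin4 : 0 <= sin th <= 1 / 4.
  by have := @sin_ge_half R th; have := sin_le th0; lra.
have cos_th_ge : 31 / 32 <= cos th.
  have := cos_ge th; have : th ^+ 2 <= (1 / 4) ^+ 2 by rewrite lerXn2r// nnegrE; lra.
  lra.
case/andP: sin4 => sin0 sin4.
have Lsin : 0 <= L * sin th <= r.
  rewrite mulr_ge0//=; have := ler_wpM2l L0 sin4; lra.
have := sqrt_sub_sqr_ge Lsin; rewrite mulNr sqrrN.
by have := ler_wpM2l L0 sin4; have := ler_wpM2l L0 cos_th_ge; lra.
Qed.

Lemma Fav_cantorK_ge_square r n : 1 <= r ->
  (((2 * pi)^-1 * (4 ^- n / 8))%:E <= Fav (sigma r) (cantorK n))%E.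
Proof.
move=> r1; have n0 : 0 < 4 ^- n :> R := inv_exp4_gt0 R n.
have n1 : 4 ^- n <= 1 :> R by rewrite invf_le1 ?exprn_gt0// exprn_ege1// ler1n.
have edge t : 0 <= t <= 4 ^- n -> cantorK n (t, 0 : R).
  have left0 : cantor_left n (0 : R) by elim: (n) => // k ih; exists 0 => //; left.
  move=> t_itv; split; exists 0 => //; rewrite /= in_itv/= add0r//.
  by rewrite lexx ltW.
have -> : 4 ^- n / 8 = 1 / 4 * \sum_(i < 1) (4 ^- n / 2) :> R.
  by rewrite big_ord1; lra.
apply: (@Fav_ge_grid _ _ _ 1 (fun=> 4 ^- n / 2) 0 (1 / 4)) => //.
  by have := pi_ge2 R; lra.
move=> i th; rewrite ltnS leqn0 => /eqP ->; rewrite mul0r mul1r !add0r => th_itv.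
apply: (@le_trans _ _ (lebesgue_measure `[0 : R, 4 ^- n / 2]%classic)).
  by rewrite lebesgue_measure_itv/= lte_fin divr_gt0// -EFinD subr0.
apply: le_mu_ext; apply: shadow_horizontal_edge => //; first by rewrite ltW.
exact: cantorK_unit_square.
Qed.

End FavardFirstSquare.

Lemma powR_ge_linear (R : realType) (b k c : R) : 1 < b -> 0 < k ->
  \forall n \near \oo, c * n%:R <= b `^ (n%:R * k).
Proof.
move=> b1 k0; have b0 : 0 < b := lt_trans ltr01 b1.
have lnb : 0 < k * ln b by rewrite mulr_gt0// ln_gt0.
near=> n; rewrite /powR gt_eqF// -mulrA; set x := n%:R * _.
have x0 : 0 <= x by rewrite mulr_ge0// ltW.
apply: le_trans (_ : 1 + x ^+ 2 / 2 <= _); last exact: expR_ge1Dxn.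
have : 2 * c <= (k * ln b) ^+ 2 * n%:R.
  rewrite -ler_pdivrMl ?exprn_gt0//; near: n; exact: nbhs_infty_ger.
move=> /(ler_wpM2r (ler0n R n)); rewrite /x exprMn; lra.
Unshelve. all: by end_near. Qed.

Theorem theorem2 (R : realType) (r : nat -> R) :
  (forall n : nat, (1 <= n)%N -> 4 `^ (n%:R / 5) <= r n) ->
  exists2 C : R, 0 < C &
    forall n : nat, (2 <= n)%N ->
      ((C * ln n%:R / n%:R)%:E <= Fav (sigma (r n)) (cantorK n))%E.
Proof.
move=> r_ge; have [c c0 Fav_ge] := Fav_cantorK_ge_log R.
have r_linear : \forall n \near \oo, 100 * n%:R <= 4 `^ (n%:R / 5) :> R.
  by apply: powR_ge_linear; rewrite ?ltr1n ?invr_gt0.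
have [N _ large] := filterI Fav_ge r_linear.
pose c_small : R := (2 * pi)^-1 * (4 ^- N / 8).
have cs0 : 0 < c_small by rewrite !mulr_gt0 ?inv_exp4_gt0 ?invr_gt0 ?mulr_gt0 ?pi_gt0.
exists (Num.min c c_small) => [|n n2]; first by rewrite lt_min c0.
have n1 : (1 <= n)%N := ltnW n2.
have log_ge0 : 0 <= ln n%:R / n%:R :> R by rewrite divr_ge0 ?ln_ge0 ?ler1n.
have [/large[Fav_n rn]|/ltnW nN] := leqP N n.
  apply: le_trans (Fav_n _ (le_trans rn (r_ge n n1))); rewrite lee_fin -!mulrA.
  by rewrite ler_wpM2r ?ge_min ?lexx.
have rn1 : 1 <= r n.
  by rewrite (le_trans _ (r_ge n n1))// -[leLHS](powRr0 4) ler_powR ?ler1n.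
apply: le_trans (Fav_cantorK_ge_square n rn1); rewrite lee_fin -mulrA.
have log_le1 : ln n%:R / n%:R <= 1 :> R.
  by rewrite ler_pdivrMr ?ltr0n// mul1r ltW// ln_sublinear ?ltr0n.
apply: (@le_trans _ _ c_small).
  by rewrite -[leRHS]mulr1 ler_pM// ?le_min ?ge_min ?lexx ?orbT ?ltW.
rewrite ler_wpM2l ?invr_ge0 ?mulr_ge0 ?pi_ge0//.
by rewrite ler_pM2r// lef_pV2 ?posrE ?exprn_gt0// ler_weXn2l// ler1n.
Qed.
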